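(* Let $p$ be an odd prime and let $F$ and $H$ be circulant graphs, each with $p$ vertices. If $F$ and $H$ are singularly cospectral, then $F$ and $H$ are isomorphic.
   Context: A circulant graph of order $n$ is a graph isomorphic to some $G(\mathbb{Z}_n,S)$, where $S\subseteq\mathbb{Z}_n\setminus\{0\}$ with $S=-S$, the vertex set is $\mathbb{Z}_n$, and $i,j$ are adjacent iff $j-i\in S$. Two graphs on the same number of vertices are singularly cospectral if the multisets of absolute values of their nonzero adjacency eigenvalues (counted with multiplicity) coincide. *)

(* Defs.v *)
From HB Require Import structures.
From mathcomp Require Import all_boot all_order all_algebra all_field.

Set Implicit Arguments.
Unset Strict Implicit.
Unset Printing Implicit Defensive.

Import Order.TTheory GRing.Theory Num.Theory.

Local Open Scope ring_scope.

Record sgraph := SGraph {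
  vertex :> finType;
  adj : rel vertex;
  adj_sym : symmetric adj;
  adj_irr : irreflexive adj
}.

Definition graph_iso (F H : sgraph) : Prop :=
  exists2 f : F -> H, bijective f & {mono f : x y / adj x y}.

(* Z_n is ['I_n] with its canonical additive group structure, which requires
   n to be a successor; unlike ['Z_n], this is correct for n = 1 as well. *)
Definition circ_adj (m : nat) (S : {set 'I_m.+1}) : rel 'I_m.+1 :=
  fun i j => j - i \in S.

Lemma circ_adj_sym (m : nat) (S : {set 'I_m.+1}) :
  S = [set - x | x in S] -> symmetric (circ_adj S).
Proof.
move=> SN i j; rewrite /circ_adj {1}SN -[j - i]opprB mem_imset //.
exact: oppr_inj.
Qed.

Lemma circ_adj_irr (m : nat) (S : {set 'I_m.+1}) :
  0 \notin S -> irreflexive (circ_adj S).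
Proof. by move=> S0 i; rewrite /circ_adj subrr; apply: negbTE. Qed.

Definition circ_graph (m : nat) (S : {set 'I_m.+1})
    (S0 : 0 \notin S) (SN : S = [set - x | x in S]) : sgraph :=
  SGraph (circ_adj_sym SN) (circ_adj_irr S0).

Definition circulant (n : nat) (G : sgraph) : Prop :=
  exists (m : nat) (S : {set 'I_m.+1})
         (S0 : 0 \notin S) (SN : S = [set - x | x in S]),
    n = m.+1 /\ graph_iso G (circ_graph S0 SN).

(* Vertices are indexed through their enumeration; the spectrum does not depend
   on that choice.  Eigenvalues of an integer matrix are algebraic, so [algC]
   contains all of them. *)
Definition adj_mx (G : sgraph) : 'M[algC]_#|G| :=
  \matrix_(i, j) (adj (enum_val i) (enum_val j))%:R.

(* The roots of the (monic) characteristic polynomial, with multiplicity. *)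
Definition spectrum (n : nat) (A : 'M[algC]_n) : seq algC :=
  sval (closed_field_poly_normal (char_poly A)).

Lemma spectrumE (n : nat) (A : 'M[algC]_n) :
  char_poly A = \prod_(x <- spectrum A) ('X - x%:P).
Proof.
rewrite /spectrum; case: (closed_field_poly_normal _) => r /= {1}->.
by rewrite (monicP (char_poly_monic A)) scale1r.
Qed.

Definition nz_abs_spectrum (G : sgraph) : seq algC :=
  [seq `|x| | x <- spectrum (adj_mx G) & x != 0].

Definition singularly_cospectral (F H : sgraph) : Prop :=
  #|F| = #|H| /\ perm_eq (nz_abs_spectrum F) (nz_abs_spectrum H).

(* Main.v *)
Require Import Defs.
From mathcomp Require Import all_boot all_order all_fingroup all_algebra.
From mathcomp Require Import all_solvable all_field.

(** Let w be a primitive p-th root of unity.  The eigenvalues of the circulant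
    graph on Z_p with connection set S are the real numbers
    l_k(S) = \sum_(s in S) w^(k s), because the discrete Fourier transform turns
    the adjacency operator, a convolution, into a multiplication.  Hence, if S
    is nonempty, the nonzero number |l_1(S)| equals |l_k(T)| for some k, so that
    l_1(S) = c l_k(T) with c = 1 or c = -1.  As 1 + X + ... + X^(p-1) is the
    minimal polynomial of w, rational relations between 1, w, ..., w^(p-1) have
    constant coefficients.  If p divides k, then l_k(T) = #|T|, and comparing
    coefficients forces #|T| = 1, which is impossible for a symmetric set that
    avoids 0 since p is odd.  Otherwise l_k(T) = l_1(k T), and comparing
    coefficients, with 0 in neither set, forces S = k T; multiplication by k is
    then the required isomorphism. *)

Set Implicit Arguments.
Unset Strict Implicit.
Unset Printing Implicit Defensive.

Import Order.TTheory GRing.Theory Num.Theory.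

Local Open Scope ring_scope.

Lemma graph_iso_sym F H : graph_iso F H -> graph_iso H F.
Proof.
case=> f [g fK gK] mono_f; exists g; first by exists f.
by move=> x y; rewrite -mono_f !gK.
Qed.

Lemma graph_iso_trans F G H : graph_iso F G -> graph_iso G H -> graph_iso F H.
Proof.
case=> f bij_f mono_f [g bij_g mono_g]; exists (g \o f); first exact: bij_comp.
by move=> x y /=; rewrite mono_g mono_f.
Qed.

Lemma eigenvalue_adj_mxP (G : sgraph) (a : algC) :
  reflect (exists2 f : G -> algC,
             forall y, \sum_x f x * (adj x y)%:R = a * f y
             & exists x, f x != 0)
          (eigenvalue (adj_mx G) a).
Proof.
have sum_enum_val (F : G -> algC) : \sum_x F x = \sum_(i < #|G|) F (enum_val i).
  by rewrite -big_enum_val.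
apply: (iffP eigenvalueP) => [[v vA /rV0Pn[i nz_vi]] | [f fA [x nz_fx]]].
  exists (fun x => v 0 (enum_rank x)) => [y|]; last first.
    by exists (enum_val i); rewrite enum_valK.
  have /rowP/(_ (enum_rank y)) := vA; rewrite !mxE => <-.
  rewrite sum_enum_val; apply: eq_bigr => j _.
  by rewrite mxE enum_valK enum_rankK.
exists (\row_i f (enum_val i)).
  apply/rowP => j; rewrite !mxE -fA sum_enum_val.
  by apply: eq_bigr => i _; rewrite !mxE.
by apply/rV0Pn; exists (enum_rank x); rewrite mxE enum_rankK.
Qed.

Lemma graph_iso_eigenvalue (F H : sgraph) :
  graph_iso F H -> eigenvalue (adj_mx F) =1 eigenvalue (adj_mx H).
Proof.
move=> isoFH a.
suff transfer F' H' :
    graph_iso F' H' -> eigenvalue (adj_mx F') a -> eigenvalue (adj_mx H') a.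
  by apply/idP/idP; apply: transfer => //; apply: graph_iso_sym.
case=> f [g fK gK] mono_f /eigenvalue_adj_mxP[u uA [x nz_ux]].
apply/eigenvalue_adj_mxP; exists (u \o g); last by exists (f x); rewrite /= fK.
move=> y /=; rewrite -uA (reindex f) /=; last by apply: onW_bij; exists g.
by apply: eq_bigr => z _; rewrite fK -{1}(gK y) mono_f.
Qed.

Lemma mem_spectrum n (A : 'M[algC]_n) a : (a \in spectrum A) = eigenvalue A a.
Proof. by rewrite eigenvalue_root_char spectrumE root_prod_XsubC. Qed.

Lemma nz_abs_spectrumP (G : sgraph) (b : algC) :
  reflect (exists a, [/\ eigenvalue (adj_mx G) a, a != 0 & b = `|a|])
          (b \in nz_abs_spectrum G).
Proof.
apply: (iffP mapP) => [[a] | [a [Ga nz_a ->]]].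
  by rewrite mem_filter mem_spectrum => /andP[nz_a Ga] ->; exists a.
by exists a => //; rewrite mem_filter nz_a mem_spectrum.
Qed.

Lemma graph_iso_nz_abs_spectrum (F H : sgraph) :
  graph_iso F H -> nz_abs_spectrum F =i nz_abs_spectrum H.
Proof.
move=> /graph_iso_eigenvalue eqFH b.
by apply/nz_abs_spectrumP/nz_abs_spectrumP=> -[a aP]; exists a;
  rewrite eqFH in aP *.
Qed.

Lemma mulrnI_coprime (V : finZmodType) (k : nat) :
  coprime #|V| k -> injective (fun x : V => x *+ k).
Proof.
rewrite -cardsT => /(expgK (G := [set: V]%G))/can_in_inj inj_k x y.
by apply: inj_k; rewrite inE.
Qed.

Lemma card_opp_closed_neq1 (V : finZmodType) (S : {set V}) :
  odd #|V| -> 0 \notin S -> S = [set - x | x in S] -> #|S| != 1%N.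
Proof.
move=> odd_V S0 SN; apply: contraNN S0 => /cards1P[s defS].
have : - s \in S by rewrite SN imset_f // defS set11.
rewrite defS !inE eq_sym -addr_eq0 -mulr2n => /eqP s2.
apply/eqP/esym/(mulrnI_coprime (k := 2)); last by rewrite /= mul0rn.
by rewrite coprimen2.
Qed.

Definition dft (R : nzRingType) (n : nat) (w : R) (f : 'I_n -> R) (k : nat) :
  R := \sum_(i < n) f i * w ^+ (k * i).

Section DiscreteFourierTransform.

Variables (R : idomainType) (m : nat) (w : R).
Hypothesis prim_w : m.+1.-primitive_root w.

Lemma prim_root_exprD k (x y : 'I_m.+1) :
  w ^+ (k * (x + y)%R) = w ^+ (k * x) * w ^+ (k * y).
Proof.
rewrite -exprD -mulnDr -(prim_expr_mod prim_w) /= modnMmr.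
exact: prim_expr_mod.
Qed.

Lemma prim_root_exprMn j k (x : 'I_m.+1) :
  w ^+ (j * (x *+ k)%R) = w ^+ (j * k * x).
Proof.
rewrite Zp_mulrn -(prim_expr_mod prim_w) /= modnMmr (prim_expr_mod prim_w).
by rewrite -mulnA [(x * k)%N]mulnC.
Qed.

Lemma dft_shift (f : 'I_m.+1 -> R) (x : 'I_m.+1) k :
  dft w (fun y => f (y - x)) k = w ^+ (k * x) * dft w f k.
Proof.
rewrite /dft (reindex (+%R x)); last first.
  by apply: onW_bij; exists (+%R (- x)); [apply: addKr | apply: addNKr].
rewrite mulr_sumr; apply: eq_bigr => y _.
by rewrite addrAC subrr add0r prim_root_exprD mulrCA.
Qed.

Lemma dft_convolution (f g : 'I_m.+1 -> R) k :
  dft w (fun y => \sum_x f x * g (y - x)) k = dft w f k * dft w g k.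
Proof.
rewrite /dft; under eq_bigr do rewrite mulr_suml.
rewrite exchange_big mulr_suml; apply: eq_bigr => x _.
rewrite -mulrA -[X in _ = _ * X]dft_shift mulr_sumr.
by apply: eq_bigr => y _; rewrite mulrA.
Qed.

Lemma exists_dft_neq0 (f : 'I_m.+1 -> R) x :
  f x != 0 -> exists k : 'I_m.+1, dft w f k != 0.
Proof.
move=> nz_fx; apply/existsP; apply: contraNT nz_fx => /existsPn dft0.
pose q := \poly_(j < m.+1) f (inord j).
have qE k : q.[w ^+ k] = dft w f k.
  by rewrite horner_poly; apply: eq_bigr => j _; rewrite inord_val exprM.
suff /polyP/(_ x) : q = 0 by rewrite coef_poly ltn_ord inord_val coef0 => ->.
apply: (@roots_geq_poly_eq0 _ q [seq w ^+ j | j : 'I_m.+1]).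
- by apply/allP => _ /mapP[j _ ->]; rewrite rootE qE; apply/negPn/dft0.
- rewrite map_inj_uniq ?enum_uniq // => j k /eqP.
  by rewrite (eq_prim_root_expr prim_w) !modn_small // => /eqP/val_inj.
- by rewrite size_map size_enum_ord size_poly.
Qed.

End DiscreteFourierTransform.

Definition dilate (m k : nat) (S : {set 'I_m.+1}) : {set 'I_m.+1} :=
  [set x *+ k | x in S].

Lemma mulrnI_ord m k : coprime m.+1 k -> injective (fun x : 'I_m.+1 => x *+ k).
Proof. by move=> co_k; apply: mulrnI_coprime; rewrite card_ord. Qed.

Lemma mem_dilate (m k : nat) (S : {set 'I_m.+1}) x :
  coprime m.+1 k -> (x *+ k \in dilate k S) = (x \in S).
Proof. by move=> co_k; rewrite (mem_imset _ _ (mulrnI_ord co_k)). Qed.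

Lemma dilate_graph_iso (m k : nat) (S T : {set 'I_m.+1})
    (S0 : 0 \notin S) (SN : S = [set - x | x in S])
    (T0 : 0 \notin T) (TN : T = [set - x | x in T]) :
    coprime m.+1 k -> S = dilate k T ->
  graph_iso (circ_graph T0 TN) (circ_graph S0 SN).
Proof.
move=> co_k defS; exists (fun x : 'I_m.+1 => x *+ k).
  exact/injF_bij/mulrnI_ord.
by move=> x y; rewrite /= /circ_adj defS -mulrnBl mem_dilate.
Qed.

Definition circ_eig (R : nzRingType) (m : nat) (w : R) (S : {set 'I_m.+1})
  (k : nat) : R := \sum_(s in S) w ^+ (k * s).

Lemma circ_eig_dft (R : nzRingType) (m : nat) (w : R) (S : {set 'I_m.+1}) k :
  circ_eig w S k = dft w (fun x => (x \in S)%:R) k.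
Proof.
rewrite /circ_eig big_mkcond; apply: eq_bigr => x _.
by case: (x \in S); rewrite ?mul1r ?mul0r.
Qed.

Section CirculantEigenvalues.

Variables (R : idomainType) (m : nat) (w : R).
Hypothesis prim_w : m.+1.-primitive_root w.

Implicit Types (S : {set 'I_m.+1}) (k : nat).

Lemma circ_eig_dvd S k : (m.+1 %| k)%N -> circ_eig w S k = #|S|%:R.
Proof.
rewrite (prim_order_dvd prim_w) => /eqP wk1; rewrite -sumr_const.
by apply: eq_bigr => s _; rewrite exprM wk1 expr1n.
Qed.

Lemma circ_eig_dilate S j k :
  coprime m.+1 k -> circ_eig w (dilate k S) j = circ_eig w S (j * k).
Proof.
move=> co_k; rewrite /circ_eig big_imset; last exact: in2W (mulrnI_ord co_k).
by apply: eq_bigr => s _; rewrite prim_root_exprMn.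
Qed.

End CirculantEigenvalues.

Lemma conjC_prim_root (n : nat) (w : algC) : n.-primitive_root w -> w^* = w^-1.
Proof.
move=> prim_w; have n_gt0 := prim_order_gt0 prim_w.
have /eqP : `|w| ^+ n = 1 by rewrite -normrX (prim_expr_order prim_w) normr1.
rewrite pexpr_eq1 // => /eqP w1.
by rewrite invC_norm w1 expr1n invr1 mul1r.
Qed.

Section CirculantSpectrum.

Variables (m : nat) (w : algC).
Hypothesis prim_w : m.+1.-primitive_root w.

Implicit Types (S : {set 'I_m.+1}) (k : nat).

Lemma circ_eig_real S k :
  S = [set - x | x in S] -> circ_eig w S k \is Num.real.
Proof.
move=> SN; rewrite CrealE /circ_eig {2}SN big_imset; last exact: in2W oppr_inj.
rewrite rmorph_sum; apply/eqP/eq_bigr => s _.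
rewrite rmorphXn /= (conjC_prim_root prim_w) exprVn; apply: mulr1_eq.
by rewrite -(prim_root_exprD prim_w k s (- s)) subrr muln0.
Qed.

(* The transform of an eigenfunction f for a is nonzero at some k, and so can be
   cancelled from dft w f k * a = dft w f k * circ_eig w S k. *)
Lemma eigenvalue_circP S (S0 : 0 \notin S) (SN : S = [set - x | x in S]) a :
  reflect (exists k, a = circ_eig w S k)
          (eigenvalue (adj_mx (circ_graph S0 SN)) a).
Proof.
apply: (iffP (eigenvalue_adj_mxP _ a)) => /= [[f fA [x nz_fx]] | [k ->]].
  have [k nz_fk] := exists_dft_neq0 prim_w nz_fx.
  exists k; apply: (mulfI nz_fk); rewrite circ_eig_dft -dft_convolution //.
  rewrite mulrC /dft mulr_sumr; apply: eq_bigr => y _.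
  by rewrite mulrA -fA.
exists (fun x : 'I_m.+1 => w ^+ (k * x)) => [y|]; last first.
  by exists 0; rewrite muln0 expr0 oner_neq0.
rewrite mulrC circ_eig_dft -dft_shift //; apply: eq_bigr => x _.
by rewrite (circ_adj_sym SN) mulrC.
Qed.

Lemma circ_nz_abs_spectrumP S (S0 : 0 \notin S)
    (SN : S = [set - x | x in S]) b :
  reflect (exists2 k, circ_eig w S k != 0 & b = `|circ_eig w S k|)
          (b \in nz_abs_spectrum (circ_graph S0 SN)).
Proof.
apply: (iffP (nz_abs_spectrumP _ b)) => [[a [Sa nz_a ->]] | [k nz_k ->]].
  by case/eigenvalue_circP: Sa nz_a => k ->; exists k.
by exists (circ_eig w S k); split=> //; apply/eigenvalue_circP; exists k.
Qed.

End CirculantSpectrum.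

Lemma sum_prim_root_expr (R : idomainType) (n : nat) (w : R) :
  (1 < n)%N -> n.-primitive_root w -> \sum_(i < n) w ^+ i = 0.
Proof.
move=> n_gt1 prim_w; have nz_w1 : w - 1 != 0.
  by rewrite subr_eq0 -(expr1 w) -(prim_order_dvd prim_w) dvdn1 gtn_eqF.
by apply: (mulfI nz_w1); rewrite mulr0 -subrX1 (prim_expr_order prim_w) subrr.
Qed.

Lemma prim_root_poly_eq0 (n : nat) (w : algC) (q : {poly rat}) :
    n.-primitive_root w -> (size q <= totient n)%N ->
  root (map_poly ratr q) w -> q = 0.
Proof.
move=> prim_w size_q; have [r [def_r _] root_r] := minCpolyP w.
rewrite root_r => r_dv_q; apply/eqP; apply: contraLR size_q => nz_q.
rewrite -ltnNge -(size_cyclotomic w) -(minCpoly_cyclotomic prim_w) def_r.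
by rewrite size_map_poly dvdp_leq.
Qed.

Section PrimeOrder.

Variables (m : nat) (w : algC).
Hypotheses (p_pr : prime m.+1) (prim_w : m.+1.-primitive_root w).

Implicit Types (S T : {set 'I_m.+1}).

Lemma prime_root_sum_eq0_const (c : 'I_m.+1 -> rat) :
  \sum_i ratr (c i) * w ^+ i = 0 -> forall i j, c i = c j.
Proof.
move=> cw0; suff c_max i : c i = c ord_max by move=> i j; rewrite !c_max.
pose q := \poly_(j < m.+1) (c (inord j) - c ord_max).
have size_q : (size q <= totient m.+1)%N.
  rewrite totient_prime //; apply/leq_sizeP => j le_mj; rewrite coef_poly ltnS.
  have [le_jm | //] := leqP j m; have -> : j = m by apply/anti_leq/andP.
  by rewrite (inord_val (@ord_max m)) subrr.
suff /polyP/(_ i)/eqP : q = 0.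
  by rewrite coef_poly ltn_ord inord_val coef0 subr_eq0 => /eqP.
apply: (prim_root_poly_eq0 prim_w size_q); rewrite rootE; apply/eqP.
rewrite (@horner_coef_wide _ m.+1) ?size_map_poly ?size_poly //.
under eq_bigr => j do
  rewrite coef_map coef_poly ltn_ord inord_val /= rmorphB mulrBl.
by rewrite sumrB cw0 -mulr_sumr sum_prim_root_expr ?prime_gt1 ?mulr0 ?subr0.
Qed.

Lemma prime_root_sum_inj (f g : 'I_m.+1 -> rat) i0 :
    f i0 = g i0 ->
    \sum_i ratr (f i) * w ^+ i = \sum_i ratr (g i) * w ^+ i ->
  f =1 g.
Proof.
move=> eq_at_i0 eq_sum i.
have const_fg : forall j k, f j - g j = f k - g k.
  apply: (prime_root_sum_eq0_const (c := fun j => f j - g j)).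
  under eq_bigr do rewrite rmorphB mulrBl.
  by rewrite sumrB eq_sum subrr.
by apply/eqP; rewrite -subr_eq0 (const_fg i i0) eq_at_i0 subrr.
Qed.

Lemma ratr_mul_circ_eig1 (c : rat) S :
  ratr c * circ_eig w S 1 = \sum_i ratr (c * (i \in S)%:R) * w ^+ i.
Proof.
rewrite circ_eig_dft /dft mulr_sumr; apply: eq_bigr => i _.
by rewrite rmorphM rmorph_nat mul1n mulrA.
Qed.

Lemma circ_eig1_rat_eqN1 S (a : rat) :
  S != set0 -> 0 \notin S -> circ_eig w S 1 = ratr a -> a = -1.
Proof.
move=> /set0Pn[s Ss] S0 eq_a.
(* As \sum_i w^i = 0, subtracting a from every coefficient does not change the
   sum; it makes the coefficient at 0 vanish, as it does for S. *)
have /(_ s) : (fun i => 1 * (i \in S)%:R) =1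
    (fun i => a * (i \in [set 0])%:R - a).
  apply: (@prime_root_sum_inj _ _ 0).
    by rewrite (negPf S0) set11 mulr1 subrr.
  rewrite -ratr_mul_circ_eig1 rmorph1 mul1r eq_a.
  under [RHS]eq_bigr do rewrite rmorphB mulrBl.
  rewrite sumrB -mulr_sumr sum_prim_root_expr ?prime_gt1 // mulr0 subr0.
  by rewrite -ratr_mul_circ_eig1 /circ_eig big_set1 muln0 mulr1.
rewrite Ss inE (negPf (memPn S0 s Ss)) mulr1 mulr0 sub0r => ->.
by rewrite opprK.
Qed.

Lemma circ_eig1_eq0 S : 0 \notin S -> (circ_eig w S 1 == 0) = (S == set0).
Proof.
move=> S0; apply/eqP/eqP => [eig0 | ->]; last by rewrite /circ_eig big_set0.
apply/eqP; apply: contraT => nz_S.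
suff /eqP : 0 = -1 :> rat by [].
by apply: circ_eig1_rat_eqN1 nz_S S0 _; rewrite rmorph0.
Qed.

Lemma circ_eig1_rat_multiple_inj S T (c : rat) :
    S != set0 -> 0 \notin S -> 0 \notin T ->
    circ_eig w S 1 = ratr c * circ_eig w T 1 ->
  S = T.
Proof.
move=> /set0Pn[s Ss] S0 T0 eq_ST.
have eq_mem : (fun i => 1 * (i \in S)%:R) =1 (fun i => c * (i \in T)%:R).
  apply: (@prime_root_sum_inj _ _ 0).
    by rewrite (negPf S0) (negPf T0) !mulr0.
  by rewrite -!ratr_mul_circ_eig1 rmorph1 mul1r.
have c1 : c = 1.
  have := eq_mem s; rewrite Ss mulr1; case: (s \in T); last by rewrite mulr0.
  by rewrite mulr1.
apply/setP => i; have /eqP := eq_mem i.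
by rewrite c1 !mul1r eqr_nat; do 2!case: (_ \in _).
Qed.

Lemma circ_eig_norm_eq_dilate S T k :
    odd m.+1 -> S != set0 -> 0 \notin S -> 0 \notin T ->
    S = [set - x | x in S] -> T = [set - x | x in T] ->
    `|circ_eig w S 1| = `|circ_eig w T k| ->
  coprime m.+1 k /\ S = dilate k T.
Proof.
move=> odd_p nz_S S0 T0 SN TN eq_norm.
have [c norm_c eq_ST] : exists2 c : rat,
    `|c| = 1 & circ_eig w S 1 = ratr c * circ_eig w T k.
  move/eqP: eq_norm; rewrite real_eqr_norm2 ?circ_eig_real // => /orP[]/eqP->.
    by exists 1; rewrite ?normr1 // rmorph1 mul1r.
  by exists (-1); rewrite ?normrN1 // rmorphN1 mulN1r.
have [dv_k | ndv_k] := boolP (m.+1 %| k)%N.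
  have eq_card : circ_eig w T k = ratr #|T|%:R.
    by rewrite ratr_nat (circ_eig_dvd prim_w).
  rewrite eq_card -rmorphM in eq_ST.
  have /(congr1 Num.norm) := circ_eig1_rat_eqN1 nz_S S0 eq_ST.
  rewrite normrM norm_c mul1r normrN1 normr_nat => /eqP.
  by rewrite pnatr_eq1 (negPf (card_opp_closed_neq1 _ T0 TN)) ?card_ord.
have co_k : coprime m.+1 k by rewrite prime_coprime.
split=> //; apply: circ_eig1_rat_multiple_inj nz_S S0 _ _.
  by rewrite -(mul0rn _ k) mem_dilate.
by rewrite circ_eig_dilate // mul1n; apply: eq_ST.
Qed.

End PrimeOrder.

Lemma circ_nz_abs_spectrum_sub_dilate (m : nat) (S T : {set 'I_m.+1})
    (S0 : 0 \notin S) (SN : S = [set - x | x in S])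
    (T0 : 0 \notin T) (TN : T = [set - x | x in T]) :
    prime m.+1 -> odd m.+1 -> S != set0 ->
    {subset nz_abs_spectrum (circ_graph S0 SN)
       <= nz_abs_spectrum (circ_graph T0 TN)} ->
  exists2 k, coprime m.+1 k & S = dilate k T.
Proof.
move=> p_pr odd_p nz_S sub_ST.
have [w prim_w] := C_prim_root_exists (ltn0Sn m).
have /sub_ST/(circ_nz_abs_spectrumP prim_w)[k _ eq_norm] :
    `|circ_eig w S 1| \in nz_abs_spectrum (circ_graph S0 SN).
  by apply/(circ_nz_abs_spectrumP prim_w); exists 1%N; rewrite ?circ_eig1_eq0.
have [] := circ_eig_norm_eq_dilate p_pr prim_w odd_p nz_S S0 T0 SN TN eq_norm.
by exists k.
Qed.

Lemma circ_nz_abs_spectrum_eq_dilate (m : nat) (S T : {set 'I_m.+1})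
    (S0 : 0 \notin S) (SN : S = [set - x | x in S])
    (T0 : 0 \notin T) (TN : T = [set - x | x in T]) :
    prime m.+1 -> odd m.+1 ->
    nz_abs_spectrum (circ_graph S0 SN) =i nz_abs_spectrum (circ_graph T0 TN) ->
  exists2 k, coprime m.+1 k & S = dilate k T.
Proof.
move=> p_pr odd_p eq_ST; have [S_eq0 | nz_S] := eqVneq S set0; last first.
  by apply: circ_nz_abs_spectrum_sub_dilate nz_S _ => // b; rewrite eq_ST.
exists 1%N; first exact: coprimen1.
rewrite S_eq0; have [-> | nz_T] := eqVneq T set0.
  by rewrite /dilate imset0.
have sub_TS : {subset nz_abs_spectrum (circ_graph T0 TN)
    <= nz_abs_spectrum (circ_graph S0 SN)} by move=> b; rewrite eq_ST.
have [k _ defT] := circ_nz_abs_spectrum_sub_dilate p_pr odd_p nz_T sub_TS.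
by case/eqP: nz_T; rewrite defT S_eq0 /dilate imset0.
Qed.

Theorem theorem5p4 (p : nat) (hp : prime p) (hodd : odd p) (F H : sgraph)
  (hF : circulant p F) (hH : circulant p H)
  (hFH : singularly_cospectral F H) : graph_iso F H.
Proof.
have [m [S [S0 [SN [def_p isoF]]]]] := hF.
have [m' [T [T0 [TN [def_p' isoH]]]]] := hH.
move: def_p'; rewrite def_p => -[def_m']; subst p m'.
have eq_ST : nz_abs_spectrum (circ_graph S0 SN) =i
             nz_abs_spectrum (circ_graph T0 TN).
  move=> b; rewrite -(graph_iso_nz_abs_spectrum isoF).
  by rewrite -(graph_iso_nz_abs_spectrum isoH) (perm_mem hFH.2).
have [k co_k defS] := circ_nz_abs_spectrum_eq_dilate hp hodd eq_ST.
apply: graph_iso_trans isoF (graph_iso_sym (graph_iso_trans isoH _)).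
exact: dilate_graph_iso co_k defS.
Qed.
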